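(* Let $A_1A_2BC_1C_2D$ be a right-angled hexagon in the hyperbolic plane. Let $A_*$ be the intersection point with the line $BD$ of the common perpendicular to $BD$ and $A_1A_2$, and let $C_*$ be the intersection point with $BD$ of the common perpendicular to $BD$ and $C_1C_2$. Then the midpoint of $\overline{BD}$ is also the midpoint of $\overline{A_*C_*}$.
   Context: A right-angled hexagon is a hexagon in the hyperbolic plane (a simple polygon whose vertices are listed in cyclic order) with six right angles. The midpoint of a degenerate segment (equal endpoints) is that endpoint. *)

(* Defs.v *)
(* The hyperbolic plane is the upper sheet of the hyperboloid
   x^2 + y^2 - t^2 = -1 in Minkowski space R^{2,1} (curvature -1). *)
From Stdlib Require Import Reals List Arith.
Import ListNotations.
Open Scope R_scope.

Record vec : Type := Vec { vx : R; vy : R; vt : R }.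

Definition vadd (u v : vec) : vec :=
  Vec (vx u + vx v) (vy u + vy v) (vt u + vt v).

Definition vscal (a : R) (u : vec) : vec :=
  Vec (a * vx u) (a * vy u) (a * vt u).

Definition mink (u v : vec) : R :=
  vx u * vx v + vy u * vy v - vt u * vt v.

Record hpoint : Type := HPoint {
  hvec :> vec;
  hvec_norm : mink hvec hvec = -1;
  hvec_pos : 0 < vt hvec
}.

Definition arcosh (x : R) : R := ln (x + sqrt (x ^ 2 - 1)).

Definition hdist (P Q : hpoint) : R := arcosh (- mink P Q).

(* For P <> Q, the geodesic through P and Q is the section of the sheet by the
   linear plane spanned by P and Q, and the segment PQ is its section by the
   cone they generate. *)
Definition line (P Q X : hpoint) : Prop :=
  exists a b : R, hvec X = vadd (vscal a P) (vscal b Q).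

Definition segment (P Q X : hpoint) : Prop :=
  exists a b : R, 0 <= a /\ 0 <= b /\ hvec X = vadd (vscal a P) (vscal b Q).

Definition is_line (l : hpoint -> Prop) : Prop :=
  exists P Q : hpoint, P <> Q /\ forall X, l X <-> line P Q X.

Definition midpoint (P Q M : hpoint) : Prop :=
  segment P Q M /\ hdist P M = hdist M Q.

(* Component of P orthogonal to V: for P <> V, a tangent vector at V (on which
   mink is positive definite) to the geodesic ray from V through P. *)
Definition dir (V P : hpoint) : vec := vadd P (vscal (mink P V) V).

(* Unoriented angle at V between the rays VP and VQ, for P, Q <> V. *)
Definition angle (P V Q : hpoint) : R :=
  acos (mink (dir V P) (dir V Q) /
        (sqrt (mink (dir V P) (dir V P)) * sqrt (mink (dir V Q) (dir V Q)))).

Definition right_angle (P V Q : hpoint) : Prop :=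
  P <> V /\ Q <> V /\ angle P V Q = PI / 2.

Definition perpendicular (l m : hpoint -> Prop) : Prop :=
  exists V, l V /\ m V /\
    forall P Q, l P -> m Q -> P <> V -> Q <> V -> right_angle P V Q.

Definition common_perpendicular (p l m : hpoint -> Prop) : Prop :=
  is_line p /\ perpendicular p l /\ perpendicular p m.

(* Simple polygon with cyclic vertex sequence v 0, ..., v (n - 1) (the values
   of v from n on are irrelevant): the vertices are distinct, and distinct sides
   meet at most in a common endpoint at which they are consecutive. *)
Definition simple_polygon (n : nat) (v : nat -> hpoint) : Prop :=
  let next i := (S i mod n)%nat in
  (3 <= n)%nat /\
  (forall i j, (i < n)%nat -> (j < n)%nat -> v i = v j -> i = j) /\
  (forall i j X, (i < n)%nat -> (j < n)%nat -> i <> j ->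
     segment (v i) (v (next i)) X -> segment (v j) (v (next j)) X ->
     (j = next i /\ X = v j) \/ (i = next j /\ X = v i)).

(* A vertex with unoriented angle PI/2 has interior angle PI/2 or 3PI/2; in a
   simple hyperbolic hexagon with all six of this kind none is reflex, since the
   interior angles add up to less than 4PI. *)
Definition right_angled_hexagon (V1 V2 V3 V4 V5 V6 : hpoint) : Prop :=
  simple_polygon 6 (fun i => nth i [V1; V2; V3; V4; V5; V6] V1) /\
  right_angle V6 V1 V2 /\ right_angle V1 V2 V3 /\ right_angle V2 V3 V4 /\
  right_angle V3 V4 V5 /\ right_angle V4 V5 V6 /\ right_angle V5 V6 V1.

(* Main.v *)
(* Let [a] and [c] be normal vectors of the lines A1A2 and C1C2.  The right angles
   at A1 and A2 make [a] proportional to the tangent vectors at A2 towards B and at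
   A1 towards D; likewise for [c].  The right angle at B then gives
   <a,c> = - <a,B> <c,B>, and the one at D gives <a,c> = - <a,D> <c,D>.
   Since Astar spans the projection of [a] to the plane of BD, <a,Y> is a constant
   times <Astar,Y> for Y on BD, hence
   <Astar,B> <Cstar,B> = <Astar,D> <Cstar,D>: in the basis (B, D), the coordinates
   of Cstar are those of Astar swapped, and B + D is proportional to
   Astar + Cstar. *)
From Stdlib Require Import Reals Psatz Nsatz ProofIrrelevance Classical.
Require Import Defs.
Open Scope R_scope.

(** * The Minkowski form on the hyperboloid *)

Lemma mink_comm u v : mink u v = mink v u.
Proof. unfold mink; ring. Qed.

Lemma mink_addl u v w : mink (vadd u v) w = mink u w + mink v w.
Proof. unfold mink, vadd; simpl; ring. Qed.

Lemma mink_scall a u w : mink (vscal a u) w = a * mink u w.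
Proof. unfold mink, vscal; simpl; ring. Qed.

Lemma mink_addr u v w : mink w (vadd u v) = mink w u + mink w v.
Proof. unfold mink, vadd; simpl; ring. Qed.

Lemma mink_scalr a u w : mink w (vscal a u) = a * mink w u.
Proof. unfold mink, vscal; simpl; ring. Qed.

Ltac mink_expand :=
  unfold dir; repeat rewrite ?mink_addl, ?mink_addr, ?mink_scall, ?mink_scalr.

Ltac mink_expand_in H :=
  unfold dir in H;
  repeat rewrite ?mink_addl, ?mink_addr, ?mink_scall, ?mink_scalr in H.

Lemma hpoint_ext (P Q : hpoint) : hvec P = hvec Q -> P = Q.
Proof.
  destruct P as [p np pp], Q as [q nq pq]; simpl; intros <-.
  f_equal; apply proof_irrelevance.
Qed.

(** Reverse Cauchy-Schwarz: for the spatial parts [p], [q], [(1 + |p|^2) (1 + |q|^2) - (1 + p.q)^2]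
    equals [|p - q|^2] plus the square of their determinant; positive heights allow taking roots. *)
Lemma mink_hpoint_le (P Q : hpoint) : mink P Q <= -1.
Proof.
  destruct P as [[x1 y1 t1] n1 p1], Q as [[x2 y2 t2] n2 p2].
  unfold mink in *; simpl in *.
  assert (0 < t1 * t2) by (apply Rmult_lt_0_compat; assumption).
  assert ((t1 * t2)² = (1 + x1 * x1 + y1 * y1) * (1 + x2 * x2 + y2 * y2))
    by (unfold Rsqr; replace (1 + x1 * x1 + y1 * y1) with (t1 * t1) by lra;
        replace (1 + x2 * x2 + y2 * y2) with (t2 * t2) by lra; ring).
  assert ((1 + x1 * x2 + y1 * y2)² <= (t1 * t2)²).
  { rewrite H0; unfold Rsqr.
    pose proof (Rle_0_sqr (x1 - x2)); pose proof (Rle_0_sqr (y1 - y2));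
    pose proof (Rle_0_sqr (x1 * y2 - x2 * y1)); unfold Rsqr in *; lra. }
  assert (1 + x1 * x2 + y1 * y2 <= t1 * t2)
    by (apply Rsqr_incr_0_var; lra).
  lra.
Qed.

Lemma mink_hpoint_eq (P Q : hpoint) : mink P Q = -1 -> P = Q.
Proof.
  intros E; apply hpoint_ext; revert E.
  destruct P as [[x1 y1 t1] n1 p1], Q as [[x2 y2 t2] n2 p2].
  unfold mink in *; simpl in *; intros E.
  assert (H : (t1 * t2)² = (1 + x1 * x2 + y1 * y2)²) by (f_equal; lra).
  assert (H' : (t1 * t2)² = (1 + x1 * x1 + y1 * y1) * (1 + x2 * x2 + y2 * y2))
    by (unfold Rsqr; replace (1 + x1 * x1 + y1 * y1) with (t1 * t1) by lra;
        replace (1 + x2 * x2 + y2 * y2) with (t2 * t2) by lra; ring).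
  pose proof (Rle_0_sqr (x1 - x2)); pose proof (Rle_0_sqr (y1 - y2));
    pose proof (Rle_0_sqr (x1 * y2 - x2 * y1)).
  assert (Hx : (x1 - x2)² = 0) by (unfold Rsqr in *; lra).
  assert (Hy : (y1 - y2)² = 0) by (unfold Rsqr in *; lra).
  apply Rsqr_0_uniq in Hx; apply Rsqr_0_uniq in Hy.
  assert (x1 = x2) by lra; assert (y1 = y2) by lra; subst.
  f_equal; apply Rsqr_inj; unfold Rsqr; lra.
Qed.

Lemma mink_hpoint_lt (P Q : hpoint) : P <> Q -> mink P Q < -1.
Proof.
  intros H; destruct (mink_hpoint_le P Q) as [|E]; trivial.
  destruct H; apply mink_hpoint_eq, E.
Qed.

(** * Tangent vectors and right angles *)

Lemma dir_norm_pos (P V : hpoint) : P <> V -> 0 < mink (dir V P) (dir V P).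
Proof.
  intros H; apply mink_hpoint_lt in H.
  mink_expand; rewrite !hvec_norm, (mink_comm V P); nra.
Qed.

(** The total [acos] takes only the values [PI] and [0] outside [[-1, 1]], so [PI / 2] is not a
    default value. *)
Lemma acos_right x : acos x = PI / 2 -> x = 0.
Proof.
  intros H; pose proof PI_RGT_0.
  destruct (Rle_dec (-1) x) as [h1|h1]; [destruct (Rle_dec x 1) as [h2|h2]|].
  - rewrite <- (cos_acos x), H by lra; apply cos_PI2.
  - unfold acos in H; destruct (Rle_dec x (-1)); [lra|].
    destruct (Rle_dec 1 x); lra.
  - unfold acos in H; destruct (Rle_dec x (-1)); lra.
Qed.

(** Hyperbolic Pythagoras: cosh PQ = cosh PV cosh VQ. *)
Lemma right_angle_mink (P V Q : hpoint) :
  right_angle P V Q -> mink P Q = - (mink P V * mink V Q).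
Proof.
  intros (HP & HQ & H); apply acos_right in H.
  assert (E : mink (dir V P) (dir V Q) = 0).
  { assert (0 < sqrt (mink (dir V P) (dir V P))) by now apply sqrt_lt_R0, dir_norm_pos.
    assert (0 < sqrt (mink (dir V Q) (dir V Q))) by now apply sqrt_lt_R0, dir_norm_pos.
    unfold Rdiv in H; apply Rmult_integral in H; destruct H as [H|H]; trivial.
    exfalso; revert H; apply Rgt_not_eq, Rinv_0_lt_compat, Rmult_lt_0_compat; assumption. }
  mink_expand_in E; rewrite hvec_norm, (mink_comm Q V) in E; lra.
Qed.

(** The Lorentzian cross product: the Euclidean one with its last coordinate negated, hence
    [mink]-orthogonal to both factors. *)
Definition cross (u v : vec) : vec :=
  Vec (vy u * vt v - vt u * vy v) (vt u * vx v - vx u * vt v)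
      (vy u * vx v - vx u * vy v).

Lemma cross_norm u v : mink (cross u v) (cross u v) = (mink u v)² - mink u u * mink v v.
Proof. unfold mink, cross, Rsqr; simpl; ring. Qed.

Lemma orthogonal_cross (u v n : vec) :
  mink n u = 0 -> mink n v = 0 ->
  vscal (mink (cross u v) (cross u v)) n = vscal (mink n (cross u v)) (cross u v).
Proof.
  destruct u as [a1 a2 a3], v as [b1 b2 b3], n as [n1 n2 n3].
  unfold mink, cross, vscal; simpl; intros Hu Hv.
  f_equal; nsatz.
Qed.

(** A line has one normal direction: both vectors are multiples of [cross P Q], whose square
    [(mink P Q)^2 - 1] is nonzero. *)
Lemma orthogonal_line_unique (P Q : hpoint) (n m : vec) :
  P <> Q -> mink n P = 0 -> mink n Q = 0 -> mink m P = 0 -> mink m Q = 0 ->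
  vscal (mink m m) n = vscal (mink n m) m.
Proof.
  intros H nP nQ mP mQ; apply mink_hpoint_lt in H.
  pose proof (orthogonal_cross _ _ _ nP nQ) as En.
  pose proof (orthogonal_cross _ _ _ mP mQ) as Em.
  assert (W : mink (cross P Q) (cross P Q) <> 0).
  { rewrite cross_norm, !hvec_norm; unfold Rsqr; nra. }
  set (w := cross P Q) in *; set (k := mink w w) in *; clearbody k w.
  assert (Sn : n = vscal (mink n w / k) w).
  { replace n with (vscal (/ k) (vscal k n)) at 1
      by (destruct n; unfold vscal; simpl; f_equal; field; trivial).
    rewrite En; unfold vscal; simpl; f_equal; field; trivial. }
  assert (Sm : m = vscal (mink m w / k) w).
  { replace m with (vscal (/ k) (vscal k m)) at 1
      by (destruct m; unfold vscal; simpl; f_equal; field; trivial).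
    rewrite Em; unfold vscal; simpl; f_equal; field; trivial. }
  set (a := mink n w / k) in Sn; set (b := mink m w / k) in Sm; clearbody a b.
  subst n m; mink_expand; unfold vscal; simpl; f_equal; ring.
Qed.

(** * Perpendicular lines and their feet *)

Lemma line_left (P Q : hpoint) : line P Q P.
Proof. exists 1, 0; destruct (hvec P); unfold vadd, vscal; simpl; f_equal; ring. Qed.

Lemma line_right (P Q : hpoint) : line P Q Q.
Proof. exists 0, 1; destruct (hvec Q); unfold vadd, vscal; simpl; f_equal; ring. Qed.

(** Any common point [F] is the vertex hidden in [perpendicular], so Pythagoras applies at [F]. *)
Lemma perpendicular_mink (p l : hpoint -> Prop) (F : hpoint) :
  perpendicular p l -> p F -> l F ->
  forall X Y, p X -> l Y -> mink X Y = - (mink X F * mink F Y).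
Proof.
  intros (V & pV & lV & H) pF lF.
  assert (F = V) as ->.
  (* Otherwise [F] would be at a right angle to itself seen from [V], giving [(mink F V)^2 = 1]. *)
  { apply NNPP; intros N.
    pose proof (right_angle_mink _ _ _ (H F F pF lF N N)) as E.
    apply N, mink_hpoint_eq; rewrite hvec_norm, (mink_comm V F) in E.
    pose proof (mink_hpoint_le F V); nra. }
  intros X Y pX lY.
  destruct (classic (X = V)) as [->|NX]; [rewrite hvec_norm; ring|].
  destruct (classic (Y = V)) as [->|NY]; [rewrite hvec_norm; ring|].
  apply right_angle_mink, H; trivial.
Qed.

(** The tangent of [p] at its foot on PQ is normal to PQ, hence proportional to [n]. So [n] lies in
    the plane of [p], and Pythagoras at [F] extends to it by linearity. *)
Lemma common_perpendicular_foot (p l : hpoint -> Prop) (P Q F : hpoint) (n : vec) :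
  P <> Q -> mink n P = 0 -> mink n Q = 0 ->
  common_perpendicular p l (line P Q) -> p F -> l F ->
  forall Y, l Y -> mink n Y = - (mink n F * mink F Y).
Proof.
  intros PQ nP nQ ((U1 & U2 & NU & Hp) & Hl & HPQ) pF lF Y lY.
  assert (HV : exists V, p V /\ line P Q V) by (destruct HPQ as (V & ? & ? & _); eauto).
  destruct HV as (V & pV & PQV).
  assert (HX : exists X, p X /\ X <> V).
  { destruct (classic (U1 = V)) as [->|N].
    - exists U2; split; [apply Hp, line_right | auto].
    - exists U1; split; [apply Hp, line_left | auto]. }
  destruct HX as (X & pX & XV).
  pose proof (perpendicular_mink _ _ _ HPQ pV PQV X) as HXV.
  assert (mP : mink (dir V X) P = 0)
    by (mink_expand; rewrite (HXV P pX (line_left P Q)); ring).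
  assert (mQ : mink (dir V X) Q = 0)
    by (mink_expand; rewrite (HXV Q pX (line_right P Q)); ring).
  pose proof (orthogonal_line_unique _ _ _ _ PQ nP nQ mP mQ) as E.
  pose proof (dir_norm_pos _ _ XV) as K.
  pose proof (perpendicular_mink _ _ _ Hl pF lF) as HF.
  assert (EY := f_equal (fun v => mink v Y) E).
  assert (EF := f_equal (fun v => mink v F) E).
  simpl in EY, EF; rewrite !mink_scall in EY, EF.
  assert (D : mink (dir V X) Y = - (mink (dir V X) F * mink F Y))
    by (mink_expand; rewrite (HF X Y), (HF V Y) by trivial; ring).
  apply (Rmult_eq_reg_l (mink (dir V X) (dir V X))); [|lra].
  rewrite EY, D.
  replace (mink (dir V X) (dir V X) * - (mink n F * mink F Y))
    with (- ((mink (dir V X) (dir V X) * mink n F) * mink F Y)) by ring.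
  rewrite EF; ring.
Qed.

(** The components of the two vectors orthogonal to [V] are orthogonal to each other, so only the
    components along [V] contribute. *)
Lemma dir_mink_right_angle (P V Q : hpoint) :
  right_angle P V Q ->
  mink (dir P V) (dir Q V) = - (mink (dir P V) V * mink (dir Q V) V).
Proof.
  intros H; apply right_angle_mink in H.
  mink_expand; rewrite !hvec_norm, (mink_comm Q V), H, !(mink_comm V P); ring.
Qed.

(** * Distances, midpoints and coordinates on a line *)

Lemma arcosh_inj x y : 1 <= x -> 1 <= y -> arcosh x = arcosh y -> x = y.
Proof.
  assert (S : forall u v, 1 <= u -> u < v -> arcosh u < arcosh v).
  { intros u v Hu Huv; unfold arcosh; apply ln_increasing.
    - pose proof (sqrt_pos (u ^ 2 - 1)); lra.
    - apply Rplus_lt_le_compat; trivial; apply sqrt_le_1_alt; nra. }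
  intros Hx Hy E; destruct (Rtotal_order x y) as [H|[H|H]]; trivial;
    apply S in H; lra.
Qed.

Lemma hdist_inj (P Q P' Q' : hpoint) : hdist P Q = hdist P' Q' -> mink P Q = mink P' Q'.
Proof.
  intros H; pose proof (mink_hpoint_le P Q); pose proof (mink_hpoint_le P' Q').
  apply arcosh_inj in H; lra.
Qed.

Lemma midpoint_vec (P Q M : hpoint) :
  P <> Q -> midpoint P Q M ->
  exists b, 0 <= b /\ hvec M = vscal b (vadd P Q).
Proof.
  intros N ((a & b & Ha & Hb & E) & H).
  apply hdist_inj in H; rewrite E in H; mink_expand_in H.
  rewrite !hvec_norm in H; apply mink_hpoint_lt in N.
  (* [H] amounts to [(b - a) * (1 + mink P Q) = 0], with [mink P Q < -1]. *)
  assert (a = b) as -> by nra.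
  exists b; split; trivial; rewrite E; unfold vadd, vscal; simpl; f_equal; ring.
Qed.

(* The hypothesis says that the reflection exchanging P and Q maps F to G. *)
Lemma symmetric_coordinates (P Q F G : hpoint) :
  P <> Q -> line P Q F -> line P Q G ->
  mink F P * mink G P = mink F Q * mink G Q ->
  exists a b, 0 < a + b /\
    hvec F = vadd (vscal a P) (vscal b Q) /\
    hvec G = vadd (vscal b P) (vscal a Q).
Proof.
  intros N (a & b & EF) (c & d & EG) H.
  apply mink_hpoint_lt in N.
  pose proof (mink_hpoint_le F P); pose proof (mink_hpoint_le F Q).
  pose proof (mink_hpoint_le G P); pose proof (mink_hpoint_le G Q).
  pose proof (hvec_norm F) as NF; pose proof (hvec_norm G) as NG.
  rewrite EF, EG in *.
  mink_expand_in NF; mink_expand_in NG; mink_expand_in H.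
  mink_expand_in H0; mink_expand_in H1; mink_expand_in H2; mink_expand_in H3.
  rewrite ?(mink_comm Q P), !hvec_norm in *.
  set (s := mink P Q) in *; clearbody s.
  (* The pairings of [F] with [P] and [Q] sum to [(a + b) * (s - 1)], which is negative, as is
     [s - 1]. *)
  assert (Hab : 0 < a + b) by nra.
  assert (Hcd : 0 < c + d) by nra.
  (* In [H] the mixed terms cancel, leaving [(1 - s * s) * (a * c - b * d) = 0]. *)
  assert (Hp : a * c = b * d).
  { apply (Rmult_eq_reg_l (1 - s * s)); [lra | nra]. }
  (* [(c, d) = k (b, a)] with [k = (c + d) / (a + b)]; the norms force [k = 1]. *)
  assert (Hc : c * (a + b) = b * (c + d)) by lra.
  assert (Hd : d * (a + b) = a * (c + d)) by lra.
  assert (Hk : (a + b)² = (c + d)²).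
  { transitivity ((- c * c - d * d + 2 * c * d * s) * - (a + b)²).
    - replace (- c * c - d * d + 2 * c * d * s) with (-1) by lra; ring.
    - transitivity (- (- (c * (a + b))² - (d * (a + b))²
                       + 2 * (c * (a + b)) * (d * (a + b)) * s));
        [unfold Rsqr; ring|].
      rewrite Hc, Hd.
      transitivity (- (- a * a - b * b + 2 * a * b * s) * (c + d)²);
        [unfold Rsqr; ring|].
      replace (- a * a - b * b + 2 * a * b * s) with (-1) by lra; ring. }
  apply Rsqr_inj in Hk; [|lra|lra].
  assert (c = b) as -> by (apply (Rmult_eq_reg_r (a + b)); [rewrite Hc, Hk; ring|lra]).
  assert (d = a) as -> by lra.
  exists a, b; auto.
Qed.

(** * The hexagon *)

Lemma opposite_sides_product (A1 A2 B C1 C2 D : hpoint) (a c : vec) :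
  right_angled_hexagon A1 A2 B C1 C2 D ->
  a = dir A2 B -> c = dir C1 B ->
  mink a B * mink c B = mink a D * mink c D.
Proof.
  intros (_ & H1 & H2 & H3 & H4 & H5 & H6) Ea Ec.
  assert (A12 : A1 <> A2) by (destruct H2; trivial).
  assert (C12 : C1 <> C2) by (destruct H5; trivial).
  assert (DA1 : 0 < mink (dir A1 D) (dir A1 D)) by (apply dir_norm_pos; apply H1).
  assert (DC2 : 0 < mink (dir C2 D) (dir C2 D)) by (apply dir_norm_pos; apply H5).
  pose proof (dir_mink_right_angle _ _ _ H3) as QB; rewrite <- Ea, <- Ec in QB.
  pose proof (dir_mink_right_angle _ _ _ H6) as QD.
  apply right_angle_mink in H1, H2, H4, H5.
  assert (Pa : vscal (mink (dir A1 D) (dir A1 D)) a = vscal (mink a (dir A1 D)) (dir A1 D)).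
  { subst a; apply (orthogonal_line_unique A1 A2); trivial; mink_expand;
      rewrite ?hvec_norm, ?(mink_comm B A1), ?(mink_comm A2 A1), ?(mink_comm B A2), ?H1, ?H2;
      ring. }
  assert (Pc : vscal (mink (dir C2 D) (dir C2 D)) c = vscal (mink c (dir C2 D)) (dir C2 D)).
  { subst c; apply (orthogonal_line_unique C1 C2); trivial; mink_expand;
      rewrite ?hvec_norm, ?(mink_comm D C1), ?(mink_comm D C2), ?(mink_comm C2 C1), ?H4, ?H5;
      ring. }
  clear H1 H2 H3 H4 H5 H6 Ea Ec.
  rewrite (mink_comm (dir C2 D)) in QD.
  set (a' := dir A1 D) in *; set (c' := dir C2 D) in *.
  assert (EaD := f_equal (fun v => mink v D) Pa); simpl in EaD.
  assert (EcD := f_equal (fun v => mink v D) Pc); simpl in EcD.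
  assert (Eac : mink (vscal (mink a' a') a) (vscal (mink c' c') c) =
                mink (vscal (mink a a') a') (vscal (mink c c') c')) by (rewrite Pa, Pc; trivial).
  rewrite !mink_scall in EaD, EcD; rewrite !mink_scall, !mink_scalr in Eac.
  (* These positive factors turn [a], [c] into multiples of [a'], [c'], to which the right angle at
     [D] applies. *)
  apply (Rmult_eq_reg_l (mink a' a' * mink c' c')); [|nra].
  transitivity (- (mink a' a' * (mink c' c' * mink a c))); [rewrite QB; ring|].
  rewrite Eac, QD.
  transitivity ((mink a' a' * mink a D) * (mink c' c' * mink c D)); [|ring].
  rewrite EaD, EcD; ring.
Qed.

Theorem theorem7 :
  forall A1 A2 B C1 C2 D : hpoint,
  right_angled_hexagon A1 A2 B C1 C2 D ->
  forall (p q : hpoint -> Prop) (Astar Cstar : hpoint),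
  common_perpendicular p (line B D) (line A1 A2) ->
  p Astar -> line B D Astar ->
  common_perpendicular q (line B D) (line C1 C2) ->
  q Cstar -> line B D Cstar ->
  forall M : hpoint, midpoint B D M -> midpoint Astar Cstar M.
Proof.
  intros A1 A2 B C1 C2 D Hex p q F G Hp pF lF Hq qG lG M HM.
  pose proof (opposite_sides_product _ _ _ _ _ _ _ _ Hex eq_refl eq_refl) as E.
  destruct Hex as ((_ & Inj & _) & _ & H2 & _ & H4 & _).
  assert (BD : B <> D).
  (* [B] and [D] have positions 2 and 5 in the vertex list, counted from 0. *)
  { intros e; specialize (Inj 2%nat 5%nat); simpl in Inj.
    assert (2 = 5)%nat by (apply Inj; trivial; lia); discriminate. }
  assert (A12 : A1 <> A2) by (destruct H2; trivial).
  assert (A2B : B <> A2) by (destruct H2 as (_ & ? & _); trivial).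
  assert (C12 : C1 <> C2) by (destruct H4 as (_ & ? & _); auto).
  assert (C1B : B <> C1) by (destruct H4; trivial).
  apply right_angle_mink in H2, H4.
  assert (Ha : forall Y, line B D Y ->
            mink (dir A2 B) Y = - (mink (dir A2 B) F * mink F Y)).
  { apply (common_perpendicular_foot p (line B D) A1 A2); trivial; mink_expand;
      rewrite ?hvec_norm, ?(mink_comm B A1), ?(mink_comm A2 A1), ?(mink_comm B A2), ?H2; ring. }
  assert (Hc : forall Y, line B D Y ->
            mink (dir C1 B) Y = - (mink (dir C1 B) G * mink G Y)).
  { apply (common_perpendicular_foot q (line B D) C1 C2); trivial; mink_expand;
      rewrite ?hvec_norm, ?H4; ring. }
  (* The value is [(mink A2 B)^2 - 1]; its nonvanishing lets the factor [k] below be cancelled, and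
     likewise [m]. *)
  assert (HaB : mink (dir A2 B) B <> 0).
  { apply mink_hpoint_lt in A2B.
    mink_expand; rewrite hvec_norm, (mink_comm A2 B); nra. }
  assert (HcB : mink (dir C1 B) B <> 0).
  { apply mink_hpoint_lt in C1B.
    mink_expand; rewrite hvec_norm, (mink_comm C1 B); nra. }
  rewrite (Ha B (line_left B D)) in HaB; rewrite (Hc B (line_left B D)) in HcB.
  rewrite (Ha B (line_left B D)), (Hc B (line_left B D)),
    (Ha D (line_right B D)), (Hc D (line_right B D)) in E.
  set (k := mink (dir A2 B) F) in *; set (m := mink (dir C1 B) G) in *.
  assert (k <> 0) by (intros e; apply HaB; rewrite e; ring).
  assert (m <> 0) by (intros e; apply HcB; rewrite e; ring).
  destruct (symmetric_coordinates B D F G) as (a & b & Hab & EF & EG); trivial.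
  { apply (Rmult_eq_reg_l (k * m)); [lra | now apply Rmult_integral_contrapositive_currified]. }
  destruct (midpoint_vec _ _ _ BD HM) as (t & Ht & EM).
  split.
  (* The coordinates add up to [F + G = (a + b) (B + D)], while [M = t (B + D)]. *)
  - assert (0 <= t / (a + b)) by (apply Rle_mult_inv_pos; trivial).
    exists (t / (a + b)), (t / (a + b)); repeat split; trivial.
    rewrite EM, EF, EG; unfold vadd, vscal; simpl; f_equal; field; lra.
  (* Exchanging [B] and [D] fixes [M] and exchanges [F] and [G]. *)
  - unfold hdist; do 2 f_equal.
    rewrite EM, EF, EG; mink_expand; rewrite !hvec_norm, (mink_comm D B); ring.
Qed.
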